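(* For every formula $\alpha\in F$: (i) if $\alpha$ is valid in the class $\mathfrak{F}_1$ of all $\hat N$-frames, then $\vdash_{\mathrm{ILM}}\alpha$; (ii) if $\alpha$ is valid in the class $\mathfrak{F}_1'$ of all $\hat N'$-frames, then $\vdash_{\mathrm{ILM}\text{-}\vee}\alpha$.
   Context: The set $F$ of formulas of $\mathrm{ILM}$ is built from propositional variables and constants $\top,\bot$ with $\wedge,\vee,\rightarrow,\neg,\sim$; $\alpha\leftrightarrow\beta$ abbreviates $(\alpha\rightarrow\beta)\wedge(\beta\rightarrow\alpha)$. Axiom schemes of $\mathrm{ILM}$: (A1) $\alpha\rightarrow(\beta\rightarrow\alpha)$; (A2) $(\alpha\rightarrow(\beta\rightarrow\gamma))\rightarrow((\alpha\rightarrow\beta)\rightarrow(\alpha\rightarrow\gamma))$; (A3) $\alpha\rightarrow(\alpha\vee\beta)$, $\beta\rightarrow(\alpha\vee\beta)$; (A4) $(\alpha\rightarrow\gamma)\rightarrow((\beta\rightarrow\gamma)\rightarrow((\alpha\vee\beta)\rightarrow\gamma))$; (A5) $(\alpha\wedge\beta)\rightarrow\alpha$, $(\alpha\wedge\beta)\rightarrow\beta$; (A6) $(\alpha\rightarrow\beta)\rightarrow((\alpha\rightarrow\gamma)\rightarrow(\alpha\rightarrow(\beta\wedge\gamma)))$; (A7) $\alpha\rightarrow\top$; (A8) $\bot\rightarrow\alpha$; (A9) $(\alpha\rightarrow\beta)\rightarrow((\alpha\rightarrow\neg\beta)\rightarrow\neg\alpha)$; (A10) $\neg\alpha\rightarrow(\alpha\rightarrow\beta)$;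 (A11) $\sim\alpha\leftrightarrow(\alpha\rightarrow\neg\neg\sim\top)$. Modus ponens is the only rule. $\mathrm{ILM}$-$\vee$ is $\mathrm{ILM}$ plus the axiom scheme $\alpha\vee\sim\alpha$. A strictly condensed $J$-frame is a triple $(X,\leq,R_N)$ with $(X,\leq)$ a poset and $R_N$ a binary relation on $X$ such that: (i) $(\leq R_N\leq^{-1})\subseteq R_N$, i.e. $x\leq x'$, $x'R_Ny'$, $y\leq y'$ imply $xR_Ny$; (ii) $R_N$ is symmetric; (iii) $\forall x,y\,(xR_Ny\Rightarrow\exists z(x\leq z\ \&\ y\leq z\ \&\ xR_Nz))$. It is a strictly condensed $H$-frame if moreover $R_N$ is reflexive. An $\hat N$-frame is $(X,\leq,R_{N_1},R_{N_2})$ such that (1) $(X,\leq,R_{N_1})$ is a strictly condensed $H$-frame; (2) $(X,\leq,R_{N_2})$ is a strictly condensed $J$-frame; (3) for all $x\in X$: if for every $y$ with $xR_{N_1}y$ there is $z$ with $yR_{N_1}z$ and no $z'$ with $zR_{N_2}z'$, then there is no $z''$ with $xR_{N_2}z''$. An $\hat N'$-frame is an $\hat N$-frame with $R_{N_2}\subseteq(\leq^{-1})$, i.e. $xR_{N_2}y$ implies $y\leq x$. A valuation assigns to each propositional variable an upset (upward closed subset) of $X$. Truth at $x$: $x\vDash p$ iff $x\in v(p)$; $\top$ is true everywhere and $\bot$ nowhere; $\wedge,\vee$ pointwise; $x\vDash\alpha\rightarrow\beta$ iff for all $y\geq x$, $y\vDash\alpha$ implies $y\vDash\beta$; $x\vDash\neg\alpha$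 iff for all $y$, $xR_{N_1}y$ implies $y\nvDash\alpha$; $x\vDash\sim\alpha$ iff for all $y$, $xR_{N_2}y$ implies $y\nvDash\alpha$. A formula is valid in a class of frames if it is true at every point under every valuation on every frame in the class. *)

(* Defs.v *)
From Stdlib Require Import Relations.

Inductive formula : Type :=
| Var  : nat -> formula
| Top  : formula
| Bot  : formula
| And  : formula -> formula -> formula
| Or   : formula -> formula -> formula
| Imp  : formula -> formula -> formula
| Neg  : formula -> formula    (* the intuitionistic negation ¬ *)
| Tild : formula -> formula.   (* the minimal negation ∼ *)

Definition Iff (a b : formula) : formula := And (Imp a b) (Imp b a).

Inductive ILM_axiom : formula -> Prop :=
| A1 a b : ILM_axiom (Imp a (Imp b a))
| A2 a b c :
    ILM_axiom (Imp (Imp a (Imp b c)) (Imp (Imp a b) (Imp a c)))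
| A3l a b : ILM_axiom (Imp a (Or a b))
| A3r a b : ILM_axiom (Imp b (Or a b))
| A4 a b c :
    ILM_axiom (Imp (Imp a c) (Imp (Imp b c) (Imp (Or a b) c)))
| A5l a b : ILM_axiom (Imp (And a b) a)
| A5r a b : ILM_axiom (Imp (And a b) b)
| A6 a b c :
    ILM_axiom (Imp (Imp a b) (Imp (Imp a c) (Imp a (And b c))))
| A7 a : ILM_axiom (Imp a Top)
| A8 a : ILM_axiom (Imp Bot a)
| A9 a b : ILM_axiom (Imp (Imp a b) (Imp (Imp a (Neg b)) (Neg a)))
| A10 a b : ILM_axiom (Imp (Neg a) (Imp a b))
| A11 a : ILM_axiom (Iff (Tild a) (Imp a (Neg (Neg (Tild Top))))).

Inductive ILM_or_axiom : formula -> Prop :=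
| ILM_or_base a : ILM_axiom a -> ILM_or_axiom a
| ILM_or_em a : ILM_or_axiom (Or a (Tild a)).

Inductive derivable (Ax : formula -> Prop) : formula -> Prop :=
| derivable_ax a : Ax a -> derivable Ax a
| derivable_mp a b :
    derivable Ax (Imp a b) -> derivable Ax a -> derivable Ax b.

Definition ILM_derivable : formula -> Prop := derivable ILM_axiom.
Definition ILM_or_derivable : formula -> Prop := derivable ILM_or_axiom.

Record strictly_condensed_J_frame (X : Type) (le RN : relation X) : Prop := {
  scJ_poset : order X le;
  scJ_condensed :
    forall x x' y y', le x x' -> RN x' y' -> le y y' -> RN x y;
  scJ_sym : symmetric X RN;
  scJ_strict :
    forall x y, RN x y -> exists z, le x z /\ le y z /\ RN x z
}.

Record strictly_condensed_H_frame (X : Type) (le RN : relation X) : Prop := {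
  scH_J : strictly_condensed_J_frame X le RN;
  scH_refl : reflexive X RN
}.

Record frame : Type := Frame {
  point : Type;
  fle : relation point;
  RN1 : relation point;
  RN2 : relation point
}.

Record Nhat_frame (F : frame) : Prop := {
  Nhat_H : strictly_condensed_H_frame (point F) (fle F) (RN1 F);
  Nhat_J : strictly_condensed_J_frame (point F) (fle F) (RN2 F);
  Nhat_stable : forall x : point F,
    (forall y, RN1 F x y ->
       exists z, RN1 F y z /\ ~ (exists z', RN2 F z z')) ->
    ~ (exists z'', RN2 F x z'')
}.

Record Nhat'_frame (F : frame) : Prop := {
  Nhat'_Nhat : Nhat_frame F;
  Nhat'_incl : forall x y : point F, RN2 F x y -> fle F y x
}.

Definition upset (X : Type) (le : relation X) (U : X -> Prop) : Prop :=
  forall x y, le x y -> U x -> U y.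

Definition valuation (F : frame) (v : nat -> point F -> Prop) : Prop :=
  forall p, upset (point F) (fle F) (v p).

Fixpoint truth (F : frame) (v : nat -> point F -> Prop) (x : point F)
    (a : formula) {struct a} : Prop :=
  match a with
  | Var p => v p x
  | Top => True
  | Bot => False
  | And b c => truth F v x b /\ truth F v x c
  | Or b c => truth F v x b \/ truth F v x c
  | Imp b c => forall y, fle F x y -> truth F v y b -> truth F v y c
  | Neg b => forall y, RN1 F x y -> ~ truth F v y b
  | Tild b => forall y, RN2 F x y -> ~ truth F v y b
  end.

Definition valid_in (C : frame -> Prop) (a : formula) : Prop :=
  forall F : frame, C F ->
  forall v : nat -> point F -> Prop, valuation F v ->
  forall x : point F, truth F v x a.

(* Main.v *)
Require Import Defs.
From Stdlib Require Import Relations Arith Cantor Classical.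
From Stdlib Require Import FunctionalExtensionality PropExtensionality.

(** Canonical models.  The points are the prime theories ordered by inclusion;
    two of them are [RN1]-related when they have a common prime extension, and
    [RN2]-related when they have one that omits [∼⊤].  Axiom (A11) makes
    [∼⊤] equivalent to [¬¬∼⊤], which is condition (3) on frames, and [∼α]
    equivalent to [α → ∼⊤], which is the truth condition of [∼].  If
    [α ∨ ∼α] is an axiom and [x RN2 y], then no [α] in [y] can have [∼α] in
    [x], so [y] is included in [x]. *)

(** * Derivability from hypotheses *)

Definition proves (Ax G : formula -> Prop) : formula -> Prop :=
  derivable (fun b => Ax b \/ G b).

Definition extend (G : formula -> Prop) (a : formula) : formula -> Prop :=
  fun b => G b \/ b = a.

Lemma derivable_mono (A B : formula -> Prop) (a : formula) :
  (forall b, A b -> derivable B b) -> derivable A a -> derivable B a.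
Proof.
  intros HAB H; induction H as [a Ha|a b _ IHab _ IHa].
  - now apply HAB.
  - exact (derivable_mp _ _ _ IHab IHa).
Qed.

Lemma proves_hyp (Ax G : formula -> Prop) (a : formula) : G a -> proves Ax G a.
Proof. intro H; apply derivable_ax; now right. Qed.

Lemma proves_mono (Ax G H : formula -> Prop) (a : formula) :
  (forall b, G b -> H b) -> proves Ax G a -> proves Ax H a.
Proof.
  intro HGH; apply derivable_mono; intros b [Hb|Hb]; apply derivable_ax; auto.
Qed.

(** Compactness along an increasing chain: a derivation has finitely many leaves, and the two
    premises of a modus ponens are both available at the later of their stages. *)
Lemma proves_chain (Ax : formula -> Prop) (S : nat -> formula -> Prop)
    (a : formula) :
  (forall m n b, m <= n -> S m b -> S n b) ->
  proves Ax (fun b => exists n, S n b) a -> exists n, proves Ax (S n) a.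
Proof.
  intros Hmono H; induction H as [a [Ha|[n Ha]]|a b _ [m IHab] _ [n IHa]].
  - exists 0; apply derivable_ax; now left.
  - exists n; now apply proves_hyp.
  - exists (Nat.max m n); apply derivable_mp with a.
    + apply proves_mono with (S m); [|assumption].
      intros c; apply Hmono, Nat.le_max_l.
    + apply proves_mono with (S n); [|assumption].
      intros c; apply Hmono, Nat.le_max_r.
Qed.

(** Numbers the formulas for the Lindenbaum construction. Injectivity is enough: at a number that
    codes no formula, the construction adds nothing. *)
Fixpoint code (a : formula) : nat :=
  match a with
  | Var n => to_nat (0, n)
  | Top => to_nat (1, 0)
  | Bot => to_nat (2, 0)
  | And b c => to_nat (3, to_nat (code b, code c))
  | Or b c => to_nat (4, to_nat (code b, code c))
  | Imp b c => to_nat (5, to_nat (code b, code c))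
  | Neg b => to_nat (6, code b)
  | Tild b => to_nat (7, code b)
  end.

Lemma code_inj (a b : formula) : code a = code b -> a = b.
Proof.
  revert b; induction a; intros []; cbn [code]; intro H;
    apply to_nat_inj in H; try discriminate H;
    apply (f_equal snd) in H; cbn [snd] in H;
    try (apply to_nat_inj in H; injection H as H H');
    f_equal; auto.
Qed.

(** * Prime theories and the canonical frame *)

Record prime_theory (Ax T : formula -> Prop) : Prop := {
  prime_closed : forall a, proves Ax T a -> T a;
  prime_consistent : ~ T Bot;
  prime_or : forall a b, T (Or a b) -> T a \/ T b
}.

Definition prime_point (Ax : formula -> Prop) : Type :=
  { T : formula -> Prop | prime_theory Ax T }.

Definition theory_of {Ax : formula -> Prop} (x : prime_point Ax) :
  formula -> Prop := proj1_sig x.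

Definition prime_le {Ax : formula -> Prop} : relation (prime_point Ax) :=
  fun x y => forall a, theory_of x a -> theory_of y a.

Definition canonical_frame (Ax : formula -> Prop) : frame := {|
  point := prime_point Ax;
  fle := prime_le;
  RN1 := fun x y => exists z, prime_le x z /\ prime_le y z;
  RN2 := fun x y => exists z, prime_le x z /\ prime_le y z /\
                              ~ theory_of z (Tild Top)
|}.

Definition canonical_valuation (Ax : formula -> Prop) :
  nat -> point (canonical_frame Ax) -> Prop :=
  fun p x => theory_of x (Var p).

Lemma theory_closed (Ax : formula -> Prop) (x : prime_point Ax) (a : formula) :
  proves Ax (theory_of x) a -> theory_of x a.
Proof. exact (prime_closed _ _ (proj2_sig x) a). Qed.

Lemma theory_mp (Ax : formula -> Prop) (x : prime_point Ax) (a b : formula) :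
  theory_of x (Imp a b) -> theory_of x a -> theory_of x b.
Proof.
  intros Hab Ha; apply theory_closed.
  apply derivable_mp with a; now apply proves_hyp.
Qed.

Lemma prime_le_antisym (Ax : formula -> Prop) :
  antisymmetric (prime_point Ax) prime_le.
Proof.
  intros [S HS] [T HT] Hxy Hyx.
  assert (S = T) as <-.
  { apply functional_extensionality; intro a; apply propositional_extensionality.
    split; [apply Hxy|apply Hyx]. }
  f_equal; apply proof_irrelevance.
Qed.

(** * Deduction theorem and Lindenbaum lemma over any axiom set containing ILM *)

Section Extension.

Context {Ax : formula -> Prop} (HAx : forall a, ILM_axiom a -> Ax a).

Lemma proves_axiom (G : formula -> Prop) (a : formula) :
  ILM_axiom a -> proves Ax G a.
Proof. intro H; apply derivable_ax; left; now apply HAx. Qed.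

Lemma proves_weaken (G : formula -> Prop) (a b : formula) :
  proves Ax G b -> proves Ax G (Imp a b).
Proof. apply derivable_mp, proves_axiom, A1. Qed.

Lemma proves_id (G : formula -> Prop) (a : formula) : proves Ax G (Imp a a).
Proof.
  apply derivable_mp with (Imp a (Imp a a)); [|apply proves_axiom, A1].
  apply derivable_mp with (Imp a (Imp (Imp a a) a)); apply proves_axiom.
  - apply A2.
  - apply A1.
Qed.

Lemma deduction (G : formula -> Prop) (a b : formula) :
  proves Ax (extend G a) b -> proves Ax G (Imp a b).
Proof.
  intro H; induction H as [b [Hb|[Hb| ->]]|b c _ IHbc _ IHb].
  - apply proves_weaken, derivable_ax; now left.
  - apply proves_weaken; now apply proves_hyp.
  - apply proves_id.
  - apply derivable_mp with (Imp a b); [|assumption].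
    apply derivable_mp with (Imp a (Imp b c)); [|assumption].
    apply proves_axiom, A2.
Qed.

(** Lindenbaum's construction: step [m] treats the formula with code [m], adding it unless [c] would
    become derivable. *)
Fixpoint stage (G : formula -> Prop) (c : formula) (n : nat) :
  formula -> Prop :=
  match n with
  | 0 => G
  | S m => fun b => stage G c m b \/
             (code b = m /\ ~ proves Ax (extend (stage G c m) b) c)
  end.

Lemma stage_mono (G : formula -> Prop) (c : formula) (m n : nat) (b : formula) :
  m <= n -> stage G c m b -> stage G c n b.
Proof. intros Hmn Hb; induction Hmn; [assumption|now left]. Qed.

Lemma stage_avoids (G : formula -> Prop) (c : formula) (n : nat) :
  ~ proves Ax G c -> ~ proves Ax (stage G c n) c.
Proof.
  intro HG; induction n as [|n IH]; [assumption|intro H].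
  destruct (classic (exists b, code b = n /\
                     ~ proves Ax (extend (stage G c n) b) c))
    as [[b [Hb Hnb]]|Hno].
  (* By injectivity of [code], [b] is the only formula this step can add, so the new stage lies
     within [extend (stage G c n) b]. *)
  - apply Hnb; revert H; apply proves_mono; intros d [Hd|[Hd _]].
    + now left.
    + right; apply code_inj; congruence.
  - apply IH; revert H; apply proves_mono; intros d [Hd|Hd]; [assumption|].
    destruct Hno; now exists d.
Qed.

(** The union [L] of the stages is maximal among the sets that do not prove [c], so [L] proves
    [a → c] for each [a] outside it. Closure, consistency and, through A4, primeness all follow,
    since their failure would make [c] derivable. *)
Lemma prime_extension (G : formula -> Prop) (c : formula) :
  ~ proves Ax G c ->
  exists x : prime_point Ax, (forall a, G a -> theory_of x a) /\
                             ~ theory_of x c.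
Proof.
  intro HG; set (L := fun b => exists n, stage G c n b).
  assert (HL : ~ proves Ax L c).
  { intro H; apply proves_chain in H; [|intros; eapply stage_mono; eauto].
    destruct H as [n Hn]; now apply (stage_avoids G c n). }
  assert (Hmax : forall a, ~ L a -> proves Ax L (Imp a c)).
  (* If [L] did not prove [a → c], then [a] would have been added right after stage [code a]. *)
  { intros a Ha; apply NNPP; intro Hn; apply Ha; exists (S (code a)); right.
    split; [reflexivity|intro H; apply Hn, deduction; revert H].
    apply proves_mono; intros b [Hb|Hb]; [left|now right].
    now exists (code a). }
  assert (Hcl : forall a, proves Ax L a -> L a).
  { intros a Ha; apply NNPP; intro Hn.
    apply HL, derivable_mp with a; [now apply Hmax|assumption]. }
  assert (HP : prime_theory Ax L).
  { split; [assumption| |].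
    - intro H; apply HL, derivable_mp with Bot; [apply proves_axiom, A8|].
      now apply proves_hyp.
    - intros a b Hab; apply NNPP; intro Hn; apply HL.
      apply derivable_mp with (Or a b); [|now apply proves_hyp].
      apply derivable_mp with (Imp b c); [|apply Hmax; tauto].
      apply derivable_mp with (Imp a c); [|apply Hmax; tauto].
      apply proves_axiom, A4. }
  exists (exist _ L HP); split.
  - intros a Ha; now exists 0.
  - intro H; apply HL; now apply proves_hyp.
Qed.

(** * Membership in a prime theory, connective by connective *)

Lemma theory_axiom (x : prime_point Ax) (a : formula) :
  ILM_axiom a -> theory_of x a.
Proof. intro H; now apply theory_closed, proves_axiom. Qed.

Lemma theory_bot (x : prime_point Ax) : ~ theory_of x Bot.
Proof. exact (prime_consistent _ _ (proj2_sig x)). Qed.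

Lemma theory_top (x : prime_point Ax) : theory_of x Top.
Proof.
  apply theory_mp with (Imp Bot Bot); apply theory_axiom; [apply A7|apply A8].
Qed.

Lemma theory_and (x : prime_point Ax) (a b : formula) :
  theory_of x (And a b) <-> theory_of x a /\ theory_of x b.
Proof.
  split.
  - intro H; split; revert H; apply theory_mp, theory_axiom;
      [apply A5l|apply A5r].
  (* A6 forms a conjunction only under a common antecedent; [Top] serves as that antecedent. *)
  - intros [Ha Hb]; apply theory_closed, derivable_mp with Top;
      [|apply proves_hyp, theory_top].
    apply derivable_mp with (Imp Top b); [|now apply proves_weaken, proves_hyp].
    apply derivable_mp with (Imp Top a); [|now apply proves_weaken, proves_hyp].
    apply proves_axiom, A6.
Qed.

Lemma theory_or (x : prime_point Ax) (a b : formula) :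
  theory_of x (Or a b) <-> theory_of x a \/ theory_of x b.
Proof.
  split; [exact (prime_or _ _ (proj2_sig x) a b)|].
  intros [H|H]; revert H; apply theory_mp, theory_axiom; [apply A3l|apply A3r].
Qed.

(** If [a → b] is missing from [x], then by the deduction theorem [x] with [a] does not prove [b],
    and a prime extension omitting [b] refutes the right side. *)
Lemma theory_imp (x : prime_point Ax) (a b : formula) :
  theory_of x (Imp a b) <->
  (forall y, prime_le x y -> theory_of y a -> theory_of y b).
Proof.
  split.
  - intros H y Hxy; apply theory_mp, Hxy, H.
  - intro H; apply NNPP; intro Hn.
    destruct (prime_extension (extend (theory_of x) a) b) as [y [Hy Hyb]].
    + intro Hd; now apply Hn, theory_closed, deduction.
    + apply Hyb, H; [intros c Hc; apply Hy; now left|apply Hy; now right].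
Qed.

Lemma theory_neg_absurd (x : prime_point Ax) (a : formula) :
  theory_of x (Neg a) -> ~ theory_of x a.
Proof.
  intros Hn Ha; apply (theory_bot x), theory_mp with a; [|assumption].
  revert Hn; apply theory_mp, theory_axiom, A10.
Qed.

Lemma theory_neg (x : prime_point Ax) (a : formula) :
  theory_of x (Neg a) <-> (forall y, prime_le x y -> ~ theory_of y a).
Proof.
  split.
  - intros H y Hxy; apply theory_neg_absurd, Hxy, H.
  (* A9 with both formulas equal to [a] reduces [¬a] to [a → ¬a], which holds vacuously above
     [x]. *)
  - intro H; apply theory_mp with (Imp a (Neg a)).
    + apply theory_mp with (Imp a a); [|apply theory_closed, proves_id].
      apply theory_axiom, A9.
    + apply theory_imp; intros y Hxy Ha; now destruct (H y Hxy).
Qed.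

Lemma theory_tild_top (x : prime_point Ax) :
  theory_of x (Neg (Neg (Tild Top))) <-> theory_of x (Tild Top).
Proof.
  pose proof (theory_axiom x _ (A11 Top)) as H; apply theory_and in H.
  destruct H as [H1 H2]; split; intro H.
  - apply (theory_mp _ _ _ _ H2), theory_imp; auto.
  - apply theory_mp with Top; [now apply (theory_mp _ _ _ _ H1)|apply theory_top].
Qed.

Lemma theory_tild (x : prime_point Ax) (a : formula) :
  theory_of x (Tild a) <->
  (forall y, prime_le x y -> theory_of y a -> theory_of y (Tild Top)).
Proof.
  pose proof (theory_axiom x _ (A11 a)) as H; apply theory_and in H.
  destruct H as [H1 H2]; split.
  - intros H y Hxy Ha; apply theory_tild_top; revert Ha.
    apply theory_mp, Hxy, (theory_mp _ _ _ _ H1), H.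
  - intro H; apply (theory_mp _ _ _ _ H2), theory_imp; intros y Hxy Ha.
    apply theory_tild_top; auto.
Qed.

(** * Truth lemma and frame conditions *)

Lemma prime_le_refl (x : prime_point Ax) : prime_le x x.
Proof. intros a Ha; exact Ha. Qed.

Lemma prime_le_trans (x y z : prime_point Ax) :
  prime_le x y -> prime_le y z -> prime_le x z.
Proof. intros Hxy Hyz a Ha; now apply Hyz, Hxy. Qed.

Lemma prime_le_order : order (prime_point Ax) prime_le.
Proof.
  split; [exact prime_le_refl|exact prime_le_trans|apply prime_le_antisym].
Qed.

Lemma truth_canonical (a : formula) (x : prime_point Ax) :
  truth (canonical_frame Ax) (canonical_valuation Ax) x a <-> theory_of x a.
Proof.
  revert x; induction a as [p| | |a IHa b IHb|a IHa b IHb|a IHa b IHb|a IHa|a IHa];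
    intro x; cbn.
  - reflexivity.
  - split; auto using theory_top.
  - split; [tauto|apply theory_bot].
  - now rewrite theory_and, IHa, IHb.
  - now rewrite theory_or, IHa, IHb.
  - rewrite theory_imp; split; intros H y Hxy; specialize (H y Hxy);
      [rewrite <- IHa, <- IHb|rewrite IHa, IHb]; exact H.
  - rewrite theory_neg; split.
    (* An extension [y] of [x] is [RN1]-related to [x], with [y] itself as common extension. *)
    + intros H y Hxy Ha; apply (H y); [|now apply IHa].
      exists y; split; [assumption|apply prime_le_refl].
    + intros H y [z [Hxz Hyz]] Ha; apply (H z Hxz), Hyz, IHa, Ha.
  - rewrite theory_tild; split.
    (* If [y] omitted [∼⊤], it would be its own witness for being [RN2]-related to [x]. *)
    + intros H y Hxy Ha; apply NNPP; intro Hn; apply (H y); [|now apply IHa].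
      exists y; auto using prime_le_refl.
    + intros H y [z [Hxz [Hyz Hz]]] Ha; apply Hz, (H z Hxz), Hyz, IHa, Ha.
Qed.

Lemma canonical_Nhat : Nhat_frame (canonical_frame Ax).
Proof.
  split; cbn.
  - split; [split|].
    + exact prime_le_order.
    + intros x x' y y' Hx [z [Hxz Hyz]] Hy.
      exists z; split; eapply prime_le_trans; eauto.
    + intros x y [z [Hxz Hyz]]; now exists z.
    + intros x y [z [Hxz Hyz]].
      exists z; split; [|split]; trivial; exists z; auto using prime_le_refl.
    + intros x; exists x; auto using prime_le_refl.
  - split.
    + exact prime_le_order.
    + intros x x' y y' Hx [z [Hxz [Hyz Hz]]] Hy.
      exists z; split; [|split]; trivial; eapply prime_le_trans; eauto.
    + intros x y [z [Hxz [Hyz Hz]]]; now exists z.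
    + intros x y [z [Hxz [Hyz Hz]]].
      exists z; split; [|split]; trivial; exists z; auto using prime_le_refl.
  (* It suffices to put [¬¬∼⊤] in [x], since then [∼⊤] lies in [w]. Suppose [¬∼⊤] is in some [y]
     above [x]. The hypothesis gives [z] without [RN2]-successors, so [z] contains [∼⊤], or it would
     be related to itself. The common extension [u] of [y] and [z] then contains both [∼⊤] and its
     negation. *)
  - intros x H [_ [w [Hxw [_ Hw]]]]; apply Hw, Hxw, theory_tild_top, theory_neg.
    intros y Hxy Hy.
    destruct (H y) as [z [[u [Hyu Hzu]] Hz]].
    { exists y; auto using prime_le_refl. }
    apply (theory_neg_absurd u (Tild Top)); [now apply Hyu|apply Hzu].
    apply NNPP; intro Hn; apply Hz; exists z, z; auto using prime_le_refl.
Qed.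

Lemma canonical_RN2_incl :
  (forall a, Ax (Or a (Tild a))) ->
  forall x y, RN2 (canonical_frame Ax) x y -> fle (canonical_frame Ax) y x.
Proof.
  intros Hem x y [z [Hxz [Hyz Hz]]] a Ha.
  assert (H : theory_of x (Or a (Tild a)))
    by (apply theory_closed, derivable_ax; left; apply Hem).
  apply theory_or in H; destruct H as [H|H]; [assumption|].
  destruct Hz; exact (proj1 (theory_tild x a) H z Hxz (Hyz a Ha)).
Qed.

(** * Completeness for both logics *)

Lemma canonical_completeness (C : frame -> Prop) (a : formula) :
  C (canonical_frame Ax) -> valid_in C a -> derivable Ax a.
Proof.
  intros HC Hv; apply NNPP; intro Hn.
  (* An underivable formula is omitted by some prime theory, obtained by extending the empty set;
     there the formula fails in the canonical model. *)
  destruct (prime_extension (fun _ => False) a) as [x [_ Hx]].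
  - intro H; apply Hn; revert H; apply derivable_mono; intros b [Hb|[]].
    now apply derivable_ax.
  - apply Hx, truth_canonical, Hv; [assumption|].
    intros p y z Hyz; apply Hyz.
Qed.

End Extension.

Theorem theorem4p14 (a : formula) :
  (valid_in Nhat_frame a -> ILM_derivable a) /\
  (valid_in Nhat'_frame a -> ILM_or_derivable a).
Proof.
  split; apply canonical_completeness; auto using ILM_or_base, canonical_Nhat.
  split; [|apply canonical_RN2_incl];
    auto using ILM_or_base, ILM_or_em, canonical_Nhat.
Qed.
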